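(* Let $\mathcal S_X=\{X_\alpha,p_\alpha^\beta,A\}$ and $\mathcal S_Y=\{Y_\alpha,q_\alpha^\beta,A\}$ be two projective Fréchet systems with the same indexing set $A$, with limit projections $p_\alpha\colon\varprojlim\mathcal S_X\to X_\alpha$ and $q_\alpha\colon\varprojlim\mathcal S_Y\to Y_\alpha$, and let $f\colon\varprojlim\mathcal S_X\to\varprojlim\mathcal S_Y$ be a continuous homomorphism. Then there exist a cofinal and $\omega$-closed subset $B_f$ of $A$ and a morphism $$\{f_\alpha\colon X_\alpha\to Y_\alpha,\ \alpha\in B_f\}\colon \mathcal S_X|B_f\to\mathcal S_Y|B_f$$ consisting of continuous homomorphisms $f_\alpha\colon X_\alpha\to Y_\alpha$, $\alpha\in B_f$, such that $f=\varprojlim\{f_\alpha;\alpha\in B_f\}$. If, in particular, $\varprojlim\mathcal S_X$ and $\varprojlim\mathcal S_Y$ are topologically isomorphic, then $\mathcal S_X$ and $\mathcal S_Y$ contain isomorphic cofinal and $\omega$-closed subsystems, i.e. there is a cofinal and $\omega$-closed subset $B\subseteq A$ such that $\mathcal S_X|B$ and $\mathcal S_Y|B$ are isomorphic.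
   Context: All algebras are over $\mathbb C$; homomorphisms are linear and multiplicative; a topological isomorphism is an algebra isomorphism that is a homeomorphism. A projective system $\mathcal S_X=\{X_\alpha,p_\alpha^\beta,A\}$ of topological algebras consists of a directed set $A$, topological algebras $X_\alpha$ ($\alpha\in A$) and continuous homomorphisms $p_\alpha^\beta\colon X_\beta\to X_\alpha$ ($\alpha\le\beta$) with $p_\alpha^\alpha=\mathrm{id}$ and $p_\alpha^\beta p_\beta^\gamma=p_\alpha^\gamma$. Its limit $\varprojlim\mathcal S_X$ is the closed subalgebra of $\prod_{\alpha\in A}X_\alpha$ consisting of all threads $\{x_\alpha\}$, i.e. those with $p_\alpha^\beta(x_\beta)=x_\alpha$ for all $\alpha\le\beta$; $p_\alpha\colon\varprojlim\mathcal S_X\to X_\alpha$ is the restriction of the coordinate projection. For a directed subset $A'\subseteq A$, $\mathcal S_X|A'$ denotes the subsystem $\{X_\alpha,p_\alpha^\beta,A'\}$. A subset $B\subseteq A$ is cofinal if every $\alpha\in A$ satisfies $\alpha\le\beta$ for some $\beta\in B$. $A$ is $\omega$-complete if every nonempty chain $C\subseteq A$ with $|C|\le\omega$ has a supremum in $A$. $B\subseteq A$ is $\omega$-closed in $A$ if for each nonempty chain $C\subseteq B$ with $|C|\le\omega$ we have $\sup C\in B$ whenever $\sup C$ exists in $A$. A projective Fréchet system is a projective system $\mathcal S_X=\{X_\alpha,p_\alpha^\beta,A\}$ of topological algebras and continuous homomorphisms such that: (1) each $X_\alpha$ is (topologically isomorphic to) a closed subalgebra of a product of at most countably many Banach algebras;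 (2) $A$ is $\omega$-complete; (3) if $\{\alpha_n\colon n\in\omega\}$ is an increasing chain in $A$ with $\alpha=\sup_n\alpha_n$, then the map $X_\alpha\to\varprojlim\{X_{\alpha_n},p_{\alpha_n}^{\alpha_{n+1}},\omega\}$, $x\mapsto\{p_{\alpha_n}^{\alpha}(x)\}_{n}$, is a topological isomorphism; (4) $p_\alpha(\varprojlim\mathcal S_X)$ is dense in $X_\alpha$ for each $\alpha\in A$. A morphism $\{f_\alpha\colon\alpha\in B\}\colon\mathcal S_X|B\to\mathcal S_Y|B$ (over the same indexing set) is a family of continuous homomorphisms $f_\alpha\colon X_\alpha\to Y_\alpha$ with $q_\alpha^\beta f_\beta=f_\alpha p_\alpha^\beta$ for all $\alpha\le\beta$ in $B$. Its limit homomorphism sends a thread $\{x_\alpha\}$ to $\{f_\alpha(x_\alpha)\}$. For $B$ cofinal, $\varprojlim(\mathcal S_X|B)$ is canonically identified with $\varprojlim\mathcal S_X$ (and likewise for $Y$), so that $f=\varprojlim\{f_\alpha;\alpha\in B\}$ means $q_\alpha f=f_\alpha p_\alpha$ for all $\alpha\in B$. The systems $\mathcal S_X|B$ and $\mathcal S_Y|B$ are isomorphic if there is a morphism $\{f_\alpha\colon\alpha\in B\}$ between them all of whose members $f_\alpha$ are topological isomorphisms. *)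

(* Defs.v *)
From HB Require Import structures.
From mathcomp Require Import all_boot all_order all_algebra.
From mathcomp Require Import complex.
From mathcomp Require Import all_classical all_reals all_analysis.

Set Implicit Arguments.
Unset Strict Implicit.
Unset Printing Implicit Defensive.

Import Order.TTheory GRing.Theory Num.Theory.
Import numFieldNormedType.Exports.

Local Open Scope classical_set_scope.
Local Open Scope ring_scope.

(* Algebras are associative but need not have a unit, so the (unital) algType
   hierarchy does not apply. *)
HB.mixin Record isTopAlgebra (K : numFieldType) A of TopologicalLmodule K A := {
  amul : A -> A -> A ;
  amulA : associative amul ;
  amulDl : left_distributive amul +%R ;
  amulDr : right_distributive amul +%R ;
  amulZl : forall (c : K) (x y : A), amul (c *: x) y = c *: amul x y ;
  amulZr : forall (c : K) (x y : A), amul x (c *: y) = c *: amul x y ;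
  amul_continuous : continuous (fun z : A * A => amul z.1 z.2) }.

#[short(type="topAlgebraType")]
HB.structure Definition TopAlgebra (K : numFieldType) :=
  {A of TopologicalLmodule K A & isTopAlgebra K A}.

HB.mixin Record isSubmultiplicative (K : numFieldType) A
    of CompleteNormedModule K A & TopAlgebra K A := {
  norm_amul : forall x y : A, `|amul x y| <= `|x| * `|y| }.

#[short(type="banachAlgebraType")]
HB.structure Definition BanachAlgebra (K : numFieldType) :=
  {A of CompleteNormedModule K A & TopAlgebra K A & isSubmultiplicative K A}.

Section Homomorphisms.
Context {K : numFieldType}.

Definition continuous_hom (X Y : topAlgebraType K) (f : X -> Y) : Prop :=
  [/\ linear f, {morph f : x y / amul x y >-> amul x y} & continuous f].

Definition topological_iso (X Y : topAlgebraType K) (f : X -> Y) : Prop :=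
  continuous_hom f /\
  exists g : Y -> X, [/\ cancel f g, cancel g f & continuous g].

Definition topologically_isomorphic (X Y : topAlgebraType K) : Prop :=
  exists f : X -> Y, topological_iso f.

End Homomorphisms.

Lemma continuous_to_initial (S : choiceType) (T Z : topologicalType)
    (f : S -> T) (g : Z -> initial_topology f) :
  continuous (f \o g) -> continuous g.
Proof.
move=> cfg; apply/continuousP => _ [B oB <-].
by move/continuousP: cfg => /(_ B oB).
Qed.

Lemma continuous_to_prod (I : eqType) (T : I -> topologicalType)
    (Z : topologicalType) (g : Z -> prod_topology T) :
  (forall i, continuous (fun z => g z i)) -> continuous g.
Proof.
move=> cg z; apply/cvg_sup => i.
exact: (@continuous_to_initial _ _ _ (fun f : forall i, T i => f i) g (cg i)).
Qed.

Lemma continuous_pairing (Z U V W : topologicalType) (op : U * V -> W)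
    (g : Z -> U) (h : Z -> V) :
  continuous op -> continuous g -> continuous h ->
  continuous (fun z => op (g z, h z)).
Proof.
move=> cop cg ch z.
apply: (@continuous_comp _ _ _ (fun z => (g z, h z)) op); last exact: cop.
by apply: cvg_pair; [exact: cg|exact: ch].
Qed.

Lemma continuous_comp_fst (U V W : topologicalType) (g : U -> W) :
  continuous g -> continuous (fun z : U * V => g z.1).
Proof.
move=> cg z; apply: (@continuous_comp _ _ _ fst g); last exact: cg.
exact: cvg_fst.
Qed.

Lemma continuous_comp_snd (U V W : topologicalType) (g : V -> W) :
  continuous g -> continuous (fun z : U * V => g z.2).
Proof.
move=> cg z; apply: (@continuous_comp _ _ _ snd g); last exact: cg.
exact: cvg_snd.
Qed.

Definition prod_algebra (K : numFieldType) (I : eqType)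
  (T : I -> topAlgebraType K) : Type := prod_topology (fun i => T i).

Section ProdAlgebra.
Context (K : numFieldType) (I : eqType) (T : I -> topAlgebraType K).
Local Notation P := (prod_algebra T).

HB.instance Definition _ := Topological.copy P (prod_topology (fun i => T i)).

Definition prod_add (x y : P) : P := fun i => x i + y i.
Definition prod_opp (x : P) : P := fun i => - x i.
Definition prod_zero : P := fun i => 0.
Definition prod_scale (c : K) (x : P) : P := fun i => c *: x i.
Definition prod_mul (x y : P) : P := fun i => amul (x i) (y i).

Fact prod_addA : associative prod_add.
Proof. by move=> x y z; apply: functional_extensionality_dep => i; exact: addrA. Qed.
Fact prod_addC : commutative prod_add.
Proof. by move=> x y; apply: functional_extensionality_dep => i; exact: addrC. Qed.
Fact prod_add0 : left_id prod_zero prod_add.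
Proof. by move=> x; apply: functional_extensionality_dep => i; exact: add0r. Qed.
Fact prod_addN : left_inverse prod_zero prod_opp prod_add.
Proof. by move=> x; apply: functional_extensionality_dep => i; exact: addNr. Qed.

HB.instance Definition _ :=
  GRing.isZmodule.Build P prod_addA prod_addC prod_add0 prod_addN.

Fact prod_scaleA (a b : K) (x : P) :
  prod_scale a (prod_scale b x) = prod_scale (a * b) x.
Proof. by apply: functional_extensionality_dep => i; exact: scalerA. Qed.
Fact prod_scale1 : left_id 1 prod_scale.
Proof. by move=> x; apply: functional_extensionality_dep => i; exact: scale1r. Qed.
Fact prod_scaleDr : right_distributive prod_scale +%R.
Proof. by move=> c x y; apply: functional_extensionality_dep => i; exact: scalerDr. Qed.
Fact prod_scaleDl (x : P) : {morph prod_scale^~ x : a b / a + b}.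
Proof. by move=> a b; apply: functional_extensionality_dep => i; exact: scalerDl. Qed.

HB.instance Definition _ :=
  GRing.Zmodule_isLmodule.Build K P prod_scaleA prod_scale1 prod_scaleDr prod_scaleDl.

Lemma prod_coord_continuous (i : I) : continuous (fun x : P => x i).
Proof. exact: (@proj_continuous I (fun i => T i) i). Qed.

Fact prod_add_continuous : continuous (fun z : P * P => z.1 + z.2).
Proof.
apply: continuous_to_prod => i.
apply: (continuous_pairing (@add_continuous (T i))).
- exact: continuous_comp_fst (@prod_coord_continuous i).
- exact: continuous_comp_snd (@prod_coord_continuous i).
Qed.

HB.instance Definition _ :=
  PreTopologicalNmodule_isTopologicalNmodule.Build P prod_add_continuous.

Fact prod_scale_continuous : continuous (fun z : K^o * P => z.1 *: z.2).
Proof.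
apply: continuous_to_prod => i.
apply: (continuous_pairing (@scale_continuous K (T i))).
- exact: (@continuous_comp_fst _ _ _ id (fun=> cvg_id)).
- exact: continuous_comp_snd (@prod_coord_continuous i).
Qed.

HB.instance Definition _ :=
  TopologicalNmodule_isTopologicalLmodule.Build K P prod_scale_continuous.

Fact prod_mulA : associative prod_mul.
Proof. by move=> x y z; apply: functional_extensionality_dep => i; exact: amulA. Qed.
Fact prod_mulDl : left_distributive prod_mul +%R.
Proof. by move=> x y z; apply: functional_extensionality_dep => i; exact: amulDl. Qed.
Fact prod_mulDr : right_distributive prod_mul +%R.
Proof. by move=> x y z; apply: functional_extensionality_dep => i; exact: amulDr. Qed.
Fact prod_mulZl (c : K) (x y : P) : prod_mul (c *: x) y = c *: prod_mul x y.
Proof. by apply: functional_extensionality_dep => i; exact: amulZl. Qed.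
Fact prod_mulZr (c : K) (x y : P) : prod_mul x (c *: y) = c *: prod_mul x y.
Proof. by apply: functional_extensionality_dep => i; exact: amulZr. Qed.
Fact prod_mul_continuous : continuous (fun z : P * P => prod_mul z.1 z.2).
Proof.
apply: continuous_to_prod => i.
apply: (continuous_pairing (@amul_continuous K (T i))).
- exact: continuous_comp_fst (@prod_coord_continuous i).
- exact: continuous_comp_snd (@prod_coord_continuous i).
Qed.

HB.instance Definition _ := isTopAlgebra.Build K P
  prod_mulA prod_mulDl prod_mulDr prod_mulZl prod_mulZr prod_mul_continuous.

End ProdAlgebra.

Record subalgebra (K : numFieldType) (X : topAlgebraType K) := Subalgebra {
  subalg_set :> set X ;
  subalg0 : subalg_set 0 ;
  subalgD : forall x y, subalg_set x -> subalg_set y -> subalg_set (x + y) ;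
  subalgZ : forall (c : K) x, subalg_set x -> subalg_set (c *: x) ;
  subalgM : forall x y,
    subalg_set x -> subalg_set y -> subalg_set (amul x y) }.

Definition subalgebra_type (K : numFieldType) (X : topAlgebraType K)
  (S : subalgebra X) : Type := set_type S.

Section SubAlgebra.
Context (K : numFieldType) (X : topAlgebraType K) (S : subalgebra X).
Local Notation U := (subalgebra_type S).

HB.instance Definition _ := SubChoice.copy U (set_type S).
HB.instance Definition _ := Topological.copy U (set_type S).

Fact subalg_submod : subsemimod_closed (fun x : X => x \in subalg_set S).
Proof.
split; [split|].
- by apply/mem_set; exact: subalg0.
- by move=> x y /set_mem xS /set_mem yS; apply/mem_set; exact: subalgD.
- by move=> c x /set_mem xS; apply/mem_set; exact: subalgZ.
Qed.

HB.instance Definition _ := GRing.SubChoice_isSubLmodule.Build K X _ U subalg_submod.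

Lemma subalgebra_val_continuous : continuous (val : U -> X).
Proof. exact: (@initial_continuous _ _ (@set_val X S)). Qed.

Fact continuous_to_sub (Z : topologicalType) (g : Z -> U) :
  continuous (fun z => val (g z)) -> continuous g.
Proof. exact: (@continuous_to_initial _ _ _ (@set_val X S)). Qed.

Fact subalg_add_continuous : continuous (fun z : U * U => z.1 + z.2).
Proof.
apply: continuous_to_sub; apply: (continuous_pairing (@add_continuous X)).
- exact: continuous_comp_fst subalgebra_val_continuous.
- exact: continuous_comp_snd subalgebra_val_continuous.
Qed.

HB.instance Definition _ :=
  PreTopologicalNmodule_isTopologicalNmodule.Build U subalg_add_continuous.

Fact subalg_scale_continuous : continuous (fun z : K^o * U => z.1 *: z.2).
Proof.
apply: continuous_to_sub; apply: (continuous_pairing (@scale_continuous K X)).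
- exact: (@continuous_comp_fst _ _ _ id (fun=> cvg_id)).
- exact: continuous_comp_snd subalgebra_val_continuous.
Qed.

HB.instance Definition _ :=
  TopologicalNmodule_isTopologicalLmodule.Build K U subalg_scale_continuous.

Definition subalg_elt (x : X) (Sx : subalg_set S x) : U :=
  exist (fun x => x \in subalg_set S) x (mem_set Sx).

Fact subalg_mul_subproof (x y : U) : subalg_set S (amul (val x) (val y)).
Proof. by apply: subalgM; apply/set_mem; exact: valP. Qed.

Definition subalg_mul (x y : U) : U := subalg_elt (subalg_mul_subproof x y).

Fact subalg_mulA : associative subalg_mul.
Proof. by move=> x y z; apply: val_inj; exact: amulA. Qed.
Fact subalg_mulDl : left_distributive subalg_mul +%R.
Proof. by move=> x y z; apply: val_inj; exact: amulDl. Qed.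
Fact subalg_mulDr : right_distributive subalg_mul +%R.
Proof. by move=> x y z; apply: val_inj; exact: amulDr. Qed.
Fact subalg_mulZl (c : K) (x y : U) : subalg_mul (c *: x) y = c *: subalg_mul x y.
Proof. by apply: val_inj; exact: amulZl. Qed.
Fact subalg_mulZr (c : K) (x y : U) : subalg_mul x (c *: y) = c *: subalg_mul x y.
Proof. by apply: val_inj; exact: amulZr. Qed.
Fact subalg_mul_continuous : continuous (fun z : U * U => subalg_mul z.1 z.2).
Proof.
apply: continuous_to_sub; apply: (continuous_pairing (@amul_continuous K X)).
- exact: continuous_comp_fst subalgebra_val_continuous.
- exact: continuous_comp_snd subalgebra_val_continuous.
Qed.

HB.instance Definition _ := isTopAlgebra.Build K U
  subalg_mulA subalg_mulDl subalg_mulDr subalg_mulZl subalg_mulZr subalg_mul_continuous.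

End SubAlgebra.

(* Meant for posets [A]; directedness is only required in [projective_frechet],
   so that restricting a system to a subset needs no side condition. *)
Record projsys (K : numFieldType) (d : Order.disp_t) (A : porderType d) :=
  Projsys {
  sys_obj :> A -> topAlgebraType K ;
  sys_map : forall a b : A, (a <= b)%O -> sys_obj b -> sys_obj a ;
  sys_map_hom : forall (a b : A) (ab : (a <= b)%O),
    continuous_hom (sys_map ab) ;
  sys_map_id : forall (a : A) (aa : (a <= a)%O) x, sys_map aa x = x ;
  sys_map_comp : forall (a b c : A)
    (ab : (a <= b)%O) (bc : (b <= c)%O) (ac : (a <= c)%O) x,
    sys_map ab (sys_map bc x) = sys_map ac x }.

Section Limit.
Context (K : numFieldType) (d : Order.disp_t) (A : porderType d).
Variable S : projsys K A.

Definition thread (x : prod_algebra S) : Prop :=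
  forall (a b : A) (ab : (a <= b)%O), sys_map ab (x b) = x a.

Fact sys_map_linear (a b : A) (ab : (a <= b)%O) (c : K) (x y : S b) :
  sys_map ab (c *: x + y) = c *: sys_map ab x + sys_map ab y.
Proof. by have [lin _ _] := sys_map_hom S ab; exact: lin. Qed.

Fact sys_map0 (a b : A) (ab : (a <= b)%O) : sys_map ab (0 : S b) = 0.
Proof.
have := sys_map_linear ab (-1) 0 0.
by rewrite scaler0 add0r scaleN1r addNr.
Qed.

Fact thread0 : thread 0.
Proof. by move=> a b ab; exact: sys_map0. Qed.

Fact threadD (x y : prod_algebra S) : thread x -> thread y -> thread (x + y).
Proof.
move=> tx ty a b ab; have := sys_map_linear ab 1 (x b) (y b).
by rewrite !scale1r tx ty.
Qed.

Fact threadZ (c : K) (x : prod_algebra S) : thread x -> thread (c *: x).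
Proof.
move=> tx a b ab; have := sys_map_linear ab c (x b) 0.
by rewrite !addr0 tx sys_map0 addr0.
Qed.

Fact threadM (x y : prod_algebra S) : thread x -> thread y -> thread (amul x y).
Proof.
move=> tx ty a b ab; have [_ mul _] := sys_map_hom S ab.
by rewrite -[amul x y a]/(amul (x a) (y a)) -(tx a b ab) -(ty a b ab) -mul.
Qed.

Definition thread_subalgebra : subalgebra (prod_algebra S) :=
  Subalgebra thread0 threadD threadZ threadM.

Definition projlim : topAlgebraType K := subalgebra_type thread_subalgebra.

Definition limproj (a : A) (x : projlim) : S a := (val x : prod_algebra S) a.

End Limit.

Section Reindexing.
Context (K : numFieldType) (d : Order.disp_t) (A : porderType d).
Variable S : projsys K A.
Context (d' : Order.disp_t) (I : porderType d') (h : I -> A).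
Hypothesis h_mono : {homo h : i j / (i <= j)%O}.

(* For [h = val] on a subset this is a subsystem; for [h : nat -> A] it is the
   inverse sequence along an increasing chain. *)
Definition reindex_sys : projsys K I := @Projsys K d' I (fun i => S (h i))
  (fun i j ij => sys_map (h_mono ij))
  (fun i j ij => sys_map_hom S (h_mono ij))
  (fun i ii x => sys_map_id (h_mono ii) x)
  (fun i j k ij jk ik x =>
     sys_map_comp (h_mono ij) (h_mono jk) (h_mono ik) x).

Variables (a : A) (ha : forall i, (h i <= a)%O).

Fact cone_thread (x : S a) :
  @thread _ _ _ reindex_sys (fun i => sys_map (ha i) x).
Proof.
by move=> i j ij; exact: (sys_map_comp (h_mono ij) (ha j) (ha i) x).
Qed.

Definition cone_map (x : S a) : projlim reindex_sys :=
  @subalg_elt _ _ (thread_subalgebra reindex_sys) _ (cone_thread x).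

End Reindexing.

Section SubIndex.
Context (d : Order.disp_t) (A : porderType d) (B : set A).

Definition subindex : Type := set_type B.
HB.instance Definition _ := SubChoice.copy subindex (set_type B).
HB.instance Definition _ := [SubChoice_isSubPOrder of subindex by <: with d].

Lemma subindex_val_mono : {homo (val : subindex -> A) : i j / (i <= j)%O}.
Proof. by []. Qed.

End SubIndex.

Definition subsystem (K : numFieldType) (d : Order.disp_t) (A : porderType d)
    (S : projsys K A) (B : set A) : projsys K (subindex B) :=
  reindex_sys S (@subindex_val_mono _ _ B).

Section Order.
Context (d : Order.disp_t) (A : porderType d).

Definition directed : Prop :=
  forall a b : A, exists c : A, (a <= c)%O /\ (b <= c)%O.

Definition cofinal (B : set A) : Prop :=
  forall a : A, exists2 b, B b & (a <= b)%O.

Definition countable_chain (C : set A) : Prop :=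
  [/\ C !=set0, countable C & total_on C (fun a b => (a <= b)%O)].

Definition omega_complete : Prop :=
  forall C : set A, countable_chain C -> exists s, supremums C s.

Definition omega_closed (B : set A) : Prop :=
  forall C : set A, C `<=` B -> countable_chain C ->
  forall s, supremums C s -> B s.

End Order.

Definition frechet_algebra (K : numFieldType) (X : topAlgebraType K) : Prop :=
  exists (I : countType) (E : I -> banachAlgebraType K)
    (S : subalgebra (prod_algebra (fun i => E i : topAlgebraType K))),
    closed (subalg_set S) /\ topologically_isomorphic X (subalgebra_type S).

(* [pf_continuous] ranges over non-strictly increasing sequences; for the
   eventually constant ones the condition holds automatically. *)
Record projective_frechet (K : numFieldType) (d : Order.disp_t)
    (A : porderType d) (S : projsys K A) : Prop := ProjectiveFrechet {
  pf_directed : directed A ;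
  pf_frechet : forall a, frechet_algebra (S a) ;
  pf_complete : omega_complete A ;
  pf_continuous : forall (u : nat -> A)
    (u_mono : {homo u : m n / (m <= n)%O}) (a : A) (ua : forall n, (u n <= a)%O),
    supremums (range u) a -> topological_iso (cone_map (S := S) u_mono ua) ;
  pf_dense : forall a, dense (range (@limproj K d A S a)) }.

Section Morphisms.
Context (K : numFieldType) (d : Order.disp_t) (A : porderType d).
Variables S T : projsys K A.

Definition sys_morphism (f : forall a, S a -> T a) : Prop :=
  (forall a, continuous_hom (f a)) /\
  (forall (a b : A) (ab : (a <= b)%O) x,
    sys_map ab (f b x) = f a (sys_map ab x)).

Definition sys_isomorphic : Prop :=
  exists f : forall a, S a -> T a,
    sys_morphism f /\ forall a, topological_iso (f a).

(* f = lim of the f_b, b in B, with the limits of S|B and T|B identified with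
   those of S and T. *)
Definition is_limit_of (B : set A) (f : projlim S -> projlim T)
    (fB : forall b : subindex B, subsystem S B b -> subsystem T B b) : Prop :=
  forall (b : subindex B) (x : projlim S),
    limproj (val b) (f x) = fB b (limproj (val b) x).

End Morphisms.

(* Main.v *)
Require Import Defs.
From mathcomp Require Import all_boot all_order all_algebra.
From mathcomp Require Import complex.
From mathcomp Require Import all_classical all_reals all_analysis.

Set Implicit Arguments.
Unset Strict Implicit.
Unset Printing Implicit Defensive.

Import Order.TTheory GRing.Theory Num.Theory.
Import numFieldNormedType.Exports.

Local Open Scope classical_set_scope.
Local Open Scope ring_scope.

(** Fix a continuous homomorphism [f] between the limits and relate [a] to [b]
    when the [a]-th coordinate of [f] is a continuous function of the [b]-th
    coordinate of its argument ([factors_through]). Over an index [a] related to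
    itself, [f] induces a map from [SX a] to [SY a]; since the image of the limit
    is dense in [SX a] and [SY a] is Hausdorff, this map is unique, is a
    homomorphism, and commutes with the bonding maps. So the wanted set is the
    diagonal of the relation, and it remains to see that this diagonal is
    cofinal and omega-closed.

    This follows from three properties of the relation
    ([diagonal_cofinal_omega_closed]). Every [a] is related to some [b]: a
    neighbourhood of 0 in the limit depends on one coordinate, a Fréchet algebra
    is described by countably many Banach coordinates, countably many indices
    are bounded in an omega-complete directed set, and bounded linear maps into
    Banach spaces extend from dense subspaces ([projlim_nbhs],
    [bounded_extension], [factors_through_exists]). The second index may be
    enlarged ([factors_through_le]). The first index may be replaced by the
    supremum of an increasing sequence, because [SY] is continuous along such
    sequences ([factors_through_sup]).

    For an isomorphism [f], the same argument is run for the conjunction of the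
    relations of [f] and of its inverse. On the diagonal the two induced maps
    are mutually inverse, again by density. *)

(** * Maps determined by their values on a dense range *)

Lemma dense_range_nbhs (X : Type) (V : topologicalType) (p : X -> V) :
  dense (range p) -> forall (v : V) (N : set V), nbhs v N -> exists x, N (p x).
Proof.
move=> dp v N; rewrite nbhsE => -[W [oW Wv] WN].
have [w [/WN Nw [x _ xw]]] : W `&` range p !=set0 by apply: dp => //; exists v.
by exists x; rewrite xw.
Qed.

Lemma dense_range_eq (X : Type) (V Z : topologicalType) (p : X -> V)
    (g h : V -> Z) : hausdorff_space Z -> dense (range p) ->
  continuous g -> continuous h -> (forall x, g (p x) = h (p x)) -> g =1 h.
Proof.
move=> hZ dp cg ch gh v; apply: hZ => A B Agv Bhv.
have nA : nbhs v (g @^-1` A) by exact: cg.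
have nB : nbhs v (h @^-1` B) by exact: ch.
have [x [Ax Bx]] := dense_range_nbhs dp (filterI nA nB).
by exists (g (p x)); split => //; rewrite gh.
Qed.

(** Used to land an extension, built coordinate by coordinate in a product of
    Banach algebras, inside the closed subalgebra that models a Fréchet
    algebra. *)
Lemma dense_range_closed (X : Type) (V Z : topologicalType) (p : X -> V)
    (g : V -> Z) (S : set Z) : closed S -> dense (range p) ->
  continuous g -> (forall x, S (g (p x))) -> forall v, S (g v).
Proof.
move=> cS dp cg gS v; apply: cS => N Ngv.
by have [x Nx] := dense_range_nbhs dp (cg v N Ngv); exists (g (p x)).
Qed.

(** Both sides of each homomorphism identity are continuous in each variable
    separately, so they may be compared on the dense range one variable at a
    time. Thanks to this, factorizations need only be tracked as continuous
    maps: their algebraic properties come for free. *)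
Lemma continuous_hom_dense (K : numFieldType) (X V Z : topAlgebraType K)
    (p : X -> V) (g : V -> Z) : hausdorff_space Z -> dense (range p) ->
  continuous_hom p -> continuous_hom (g \o p) -> continuous g ->
  continuous_hom g.
Proof.
move=> hZ dp [pl pm pc] [gl gm _] cg.
have cst (T U : topologicalType) (t : U) : continuous (fun _ : T => t).
  by move=> x; exact: cvg_cst.
have comp (h : V -> V) : continuous h -> continuous (fun v => g (h v)).
  by move=> ch v; apply: continuous_comp; [exact: ch | exact: cg].
have scal (T : topologicalType) (U : topAlgebraType K) (c : K) (h : T -> U) :
    continuous h -> continuous (fun v => c *: h v).
  move=> ch.
  exact: (@continuous_pairing _ K^o U U _ (fun=> c) h (@scale_continuous K U)).
have add (T : topologicalType) (U : topAlgebraType K) (h k : T -> U) :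
    continuous h -> continuous k -> continuous (fun v => h v + k v).
  exact: (continuous_pairing (@add_continuous U)).
have mul (T : topologicalType) (U : topAlgebraType K) (h k : T -> U) :
    continuous h -> continuous k -> continuous (fun v => amul (h v) (k v)).
  exact: (continuous_pairing (@amul_continuous K U)).
have cid : continuous (fun v : V => v) by move=> x; exact: cvg_id.
split => //.
- move=> c v w.
  apply: (@dense_range_eq _ _ _ p (fun v => g (c *: v + w))
    (fun v => c *: g v + g w) hZ dp) v => [||x].
  + exact: comp (add _ _ _ _ (scal _ _ c _ cid) (cst _ _ w)).
  + exact: add (scal _ _ c _ cg) (cst _ _ (g w)).
  apply: (@dense_range_eq _ _ _ p (fun w => g (c *: p x + w))
    (fun w => c *: g (p x) + g w) hZ dp) w => [||y].
  + exact: comp (add _ _ _ _ (cst _ _ (c *: p x)) cid).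
  + exact: add (cst _ _ (c *: g (p x))) cg.
  by rewrite -pl; exact: gl.
- move=> v w.
  apply: (@dense_range_eq _ _ _ p (fun v => g (amul v w))
    (fun v => amul (g v) (g w)) hZ dp) v => [||x].
  + exact: comp (mul _ _ _ _ cid (cst _ _ w)).
  + exact: mul cg (cst _ _ (g w)).
  apply: (@dense_range_eq _ _ _ p (fun w => g (amul (p x) w))
    (fun w => amul (g (p x)) (g w)) hZ dp) w => [||y].
  + exact: comp (mul _ _ _ _ (cst _ _ (p x)) cid).
  + exact: mul (cst _ _ (g (p x))) cg.
  by rewrite -pm; exact: gm.
Qed.

Lemma linear_eq0 (K : pzRingType) (U V : lmodType K) (h : U -> V) :
  linear h -> h 0 = 0.
Proof.
by move=> hl; have := hl (-1) 0 0; rewrite scaler0 add0r scaleN1r addNr.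
Qed.

(** Boundedness of [phi] on the preimage of a neighbourhood of 0 makes [phi]
    uniformly continuous for the topology pulled back along [p]; hence it maps
    the trace of every neighbourhood filter of [V] to a Cauchy filter of the
    complete space [E], and the extension is the limit. That [p x = p y] forces
    [phi x = phi y] is part of the conclusion. *)
Lemma bounded_extension (K : numFieldType) (X : lmodType K)
    (V : topologicalLmodType K) (E : completeNormedModType K)
    (p : X -> V) (phi : X -> E) (U : set V) :
  dense (range p) -> linear p -> linear phi -> nbhs (0 : V) U ->
  (forall x, U (p x) -> `|phi x| <= 1) ->
  exists g : V -> E, continuous g /\ forall x, g (p x) = phi x.
Proof.
move=> dp pl phil U0 phiU.
have pZ c x : p (c *: x) = c *: p x.
  by have := pl c x 0; rewrite (linear_eq0 pl) !addr0.
have phiZ c x : phi (c *: x) = c *: phi x.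
  by have := phil c x 0; rewrite (linear_eq0 phil) !addr0.
have pB x y : p (x - y) = p x - p y.
  by have := pl (-1) y x; rewrite !scaleN1r ![- _ + _]addrC.
have phiB x y : phi (x - y) = phi x - phi y.
  by have := phil (-1) y x; rewrite !scaleN1r ![- _ + _]addrC.
(* The neighbourhood is the set of [w] near [v] for which differences lie in
   [e *: U]; linearity turns the bound 1 on [U] into the bound [e]. *)
have osc (v : V) (e : K) : 0 < e -> exists2 N : set V, nbhs v N &
    forall x y, N (p x) -> N (p y) -> `|phi x - phi y| <= e.
  move=> e0.
  have cont : continuous (fun z : V * V => e^-1 *: (z.1 - z.2)).
    apply: (@continuous_pairing _ K^o V V _ (fun=> e^-1) _ (@scale_continuous K V)).
      by move=> z; exact: cvg_cst.
    exact: sub_continuous.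
  have := cont (v, v) U; rewrite /= subrr scaler0 => /(_ U0) [[N M] /= [Nv Mv] NM].
  exists (N `&` M); first exact: filterI.
  move=> x y [Nx _] [_ My]; have := NM (p x, p y) (conj Nx My).
  rewrite /= -pB -pZ => /phiU; rewrite phiZ normrZ phiB normfV gtr0_norm//.
  by rewrite mulrC ler_pdivrMr// mul1r.
(* A limit value is recorded by an estimate on a whole neighbourhood of [v],
   so that continuity of the extension is a comparison of two estimates. *)
have lim_ex (v : V) : exists l : E, forall e : K, 0 < e ->
    exists2 N : set V, nbhs v N & forall x, N (p x) -> `|phi x - l| <= e.
  pose F := filter_from (nbhs v) (fun N => phi @` (p @^-1` N)).
  have FF : ProperFilter F.
    apply: filter_from_proper; last first.
      by move=> N /(dense_range_nbhs dp)[x Nx]; exists (phi x); exists x.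
    apply: filter_from_filter; first by exists setT; exact: filterT.
    move=> N M Nv Mv; exists (N `&` M); first exact: filterI.
    by move=> _ [x [Nx Mx] <-]; split; exists x.
  have /cauchy_cvg Fcvg : cauchy F.
    apply: cauchy_exP => e e0; have e20 : 0 < e / 2 by rewrite divr_gt0.
    have [N Nv NP] := osc v (e / 2) e20.
    have [x Nx] := dense_range_nbhs dp Nv.
    exists (phi x); exists N => // _ [y Ny <-].
    rewrite -ball_normE /=; apply: le_lt_trans (NP x y Nx Ny) _.
    by rewrite ltr_pdivrMr// ltr_pMr// ltr1n.
  exists (lim F) => e e0; have e20 : 0 < e / 2 by rewrite divr_gt0.
  have [N Nv NP] := osc v (e / 2) e20; exists N => // x Nx.
  have /Fcvg [M Mv MP] : nbhs (lim F) (ball (lim F) (e / 2)) by exact: nbhsx_ballx.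
  have [y [Ny My]] := dense_range_nbhs dp (filterI Nv Mv).
  have : ball (lim F) (e / 2) (phi y) by apply: MP; exists y.
  rewrite -ball_normE /= distrC => /ltW le2.
  rewrite (splitr e) -(subrKA (phi y)); apply: le_trans (ler_normD _ _) _.
  by apply: lerD => //; exact: NP.
have [g gP] := choice lim_ex.
exists g; split=> [v|x]; last first.
  apply/eqP; rewrite -subr_eq0 -normr_le0; apply/ler_addgt0Pl => e e0.
  rewrite addr0 distrC; have [N Nx NP] := gP (p x) e e0.
  by apply: NP; exact: nbhs_singleton.
apply/cvgrPdist_le => e e0; have e20 : 0 < e / 2 by rewrite divr_gt0.
have [N Nv NP] := gP v (e / 2) e20.
near=> w.
have [M Mw MP] := gP w (e / 2) e20.
have Nw : nbhs w N by near: w; exact: nbhs_interior.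
have [x [Nx Mx]] := dense_range_nbhs dp (filterI Nw Mw).
rewrite (splitr e) -(subrKA (phi x)); apply: le_trans (ler_normD _ _) _.
by apply: lerD; [rewrite distrC; exact: NP | exact: MP].
Unshelve. all: by end_near. Qed.

(** * Diagonals of relations on omega-complete directed sets *)

Lemma sup_increasing_seq (d : Order.disp_t) (A : porderType d) (u : nat -> A) :
  omega_complete A -> {homo u : m n / (m <= n)%O} ->
  exists s, supremums (range u) s.
Proof.
move=> cA um; apply: cA; split.
- by exists (u 0%N); exists 0%N.
- exact: sub_countable (card_image_le _ _) (countableP _).
- move=> _ _ [m _ <-] [n _ <-].
  by have [/um|/um] := orP (le_total m n); [left|right].
Qed.

Lemma homo_seq (d : Order.disp_t) (A : porderType d) (u : nat -> A) :
  (forall n, (u n <= u n.+1)%O) -> {homo u : m n / (m <= n)%O}.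
Proof. by move=> uS; exact: (homo_leq (@lexx _ A) (@le_trans _ A) uS). Qed.

(** The point [a] serves as starting point, and as a filler at the naturals
    that code no index. *)
Lemma countable_family_bounded (d : Order.disp_t) (A : porderType d)
    (I : countType) (b : I -> A) (a : A) :
  directed A -> omega_complete A ->
  exists s, forall i, (b i <= s)%O.
Proof.
move=> dA cA.
have [join joinP] := choice (fun ab : A * A => dA ab.1 ab.2).
pose c n := if unpickle n is Some i then b i else a.
pose fix u n := if n is m.+1 then join (u m, c m) else a.
have um : {homo u : m n / (m <= n)%O}.
  by apply: homo_seq => n; have [] := joinP (u n, c n).
have [s [us _]] := sup_increasing_seq cA um.
exists s => i; apply: (@le_trans _ _ (u (pickle i).+1)).
  by have [_] := joinP (u (pickle i), c (pickle i)); rewrite /= {1}/c pickleK.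
by apply: us; exists (pickle i).+1.
Qed.

(** The running maximum of an enumeration of [C]: it exists because [C] is a
    chain, and it has the same upper bounds as [C]. This turns the chains in the
    definition of omega-closedness into the increasing sequences along which
    the systems are continuous. *)
Lemma countable_chain_cofinal_seq (d : Order.disp_t) (A : porderType d)
    (C : set A) (s : A) : countable_chain C -> supremums C s ->
  exists u : nat -> A, [/\ {homo u : m n / (m <= n)%O}, forall n, C (u n)
    & supremums (range u) s].
Proof.
move=> [[c0 Cc0] /countable_injP[r rinj] Ctot] [Cs smin].
(* [e n] is the point of [C] coded by [n]; the second clause only speaks when
   [n] is a code, and the default [c0] is used otherwise. *)
have eP n : exists c, C c /\ forall x, C x -> r x = n -> x = c.
  have [[c Cc rc]|nex] := pselect (exists2 c, C c & r c = n).
    by exists c; split=> // x Cx rx; apply: rinj; rewrite ?inE ?rc.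
  by exists c0; split=> // x Cx rx; case: nex; exists x.
have [e eC] := choice eP.
pose fix u n := if n is m.+1 then
  (if (u m <= e m)%O then e m else u m) else c0.
have um : {homo u : m n / (m <= n)%O}.
  by apply: homo_seq => n /=; case: ifP.
have uC n : C (u n) by elim: n => //= n ?; case: ifP => // _; case: (eC n).
have eu n : (e n <= u n.+1)%O.
  rewrite /=; case: ifPn => // nle.
  by have [/(negP nle)|] := Ctot _ _ (uC n) (eC n).1.
exists u; split=> //; split=> [_ [n _ <-]|t ut]; first exact: Cs.
apply: smin => x Cx; rewrite ((eC (r x)).2 x Cx erefl).
by apply: le_trans (eu _) _; apply: ut; exists (r x).+1.
Qed.

(** For cofinality, climb from [a] along a sequence with
    [L (u n) (u n.+1)]; its supremum [s] satisfies [L (u n) s] for all [n] by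
    monotonicity in the second argument, hence [L s s] by continuity in the
    first one. The same two properties give omega-closedness. *)
Lemma diagonal_cofinal_omega_closed (d : Order.disp_t) (A : porderType d)
    (L : A -> A -> Prop) : directed A -> omega_complete A ->
  (forall a, exists b, L a b) ->
  (forall a b c, L a b -> (b <= c)%O -> L a c) ->
  (forall (u : nat -> A) s b, {homo u : m n / (m <= n)%O} ->
    supremums (range u) s -> (forall n, L (u n) b) -> L s b) ->
  cofinal [set a | L a a] /\ omega_closed [set a | L a a].
Proof.
move=> dA cA Lex Lup Lsup; split=> [a|C CL Cchain s sC].
  have next_ex c : exists c', (c <= c')%O /\ L c c'.
    have [b Lcb] := Lex c; have [c' [cc' bc']] := dA c b.
    by exists c'; split=> //; exact: Lup bc'.
  have [next nextP] := choice next_ex.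
  pose u n := iter n next a.
  have um : {homo u : m n / (m <= n)%O}.
    by apply: homo_seq => n; have [] := nextP (u n).
  have [s us] := sup_increasing_seq cA um.
  have ules n : (u n <= s)%O by apply: us.1; exists n.
  exists s; last exact: (ules 0%N).
  apply: (Lsup u) => // n; apply: Lup (ules n.+1).
  by have [] := nextP (u n).
have [u [um uC us]] := countable_chain_cofinal_seq Cchain sC.
apply: (Lsup u) => // n; apply: Lup (CL _ (uC n)) _.
by apply: us.1; exists n.
Qed.

(** * Limits of projective systems and Fréchet algebras *)

Lemma limproj_sys_map (K : numFieldType) (d : Order.disp_t)
    (A : porderType d) (S : projsys K A)
    (a b : A) (ab : (a <= b)%O) (x : projlim S) :
  sys_map ab (limproj b x) = limproj a x.
Proof. by have /set_mem := valP x; apply. Qed.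

Lemma limproj_hom (K : numFieldType) (d : Order.disp_t)
    (A : porderType d) (S : projsys K A)
    (a : A) :
  continuous_hom (@limproj _ _ _ S a).
Proof.
split=> //; move=> x.
exact: continuous_comp (@subalgebra_val_continuous _ _ (thread_subalgebra S) x)
  (@prod_coord_continuous _ _ S a _).
Qed.

(** The product topology is generated by finitely many coordinates at a time,
    and in a directed system one large coordinate controls finitely many
    others: the sets pulled back from a single [S b] form a neighbourhood
    base. The point [a] provides the coordinate that the empty intersection
    needs. *)
Lemma projlim_nbhs (K : numFieldType) (d : Order.disp_t)
    (A : porderType d) (S : projsys K A)
    (a : A) (x : projlim S) (N : set (projlim S)) :
  directed A -> nbhs x N ->
  exists b (U : set (S b)), nbhs (limproj b x) U /\
    forall y, U (limproj b y) -> N y.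
Proof.
move=> dA.
pose D := [set bU : {b : A & set (S b)} | nbhs (limproj (tag bU) x) (tagged bU)].
pose F := filter_from D (fun bU => limproj (tag bU) @^-1` tagged bU).
(* It suffices that the filter generated by these sets converges to [x], which
   can be checked coordinatewise. *)
suff Fx : F --> x.
  by move=> /Fx[[b U] /= bU UN]; exists b, U; split=> // y; exact: UN.
have pull b c (bc : (b <= c)%O) (U : set (S b)) : nbhs (limproj b x) U ->
    nbhs (limproj c x) (sys_map bc @^-1` U).
  rewrite -(limproj_sys_map bc) => bU.
  by have [_ _ cont] := sys_map_hom S bc; exact: cont.
have FF : Filter F.
  apply: filter_from_filter.
    exists (Tagged (fun b => set (S b)) (setT : set (S a))); exact: filterT.
  move=> [b U] [c W] /= bU cW; have [e [be ce]] := dA b c.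
  exists (Tagged (fun b => set (S b))
    ((sys_map be @^-1` U) `&` (sys_map ce @^-1` W))).
    by apply: filterI; exact: pull.
  by move=> y /= []; rewrite !limproj_sys_map.
have coordF : (val @ F : set_system (prod_algebra S)) --> val x.
  apply/cvg_sup => i M; rewrite nbhsE => -[_ [[B oB <-] Bx] BM].
  exists (Tagged (fun b => set (S b)) B); first exact: open_nbhs_nbhs.
  by move=> y By; exact: BM.
move=> M; rewrite nbhsE => -[_ [[B oB <-] Bx] BM].
have FB : F (val @^-1` B) by apply: coordF; exact: open_nbhs_nbhs.
exact: filterS BM FB.
Qed.

Lemma frechet_hausdorff (K : numFieldType) (X : topAlgebraType K) :
  frechet_algebra X -> hausdorff_space X.
Proof.
move=> [I [E [S [_ [h [[_ _ ch] [k [hK _ _]]]]]]]].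
move=> x y xy; apply: (can_inj hK); apply: val_inj.
apply: functional_extensionality_dep => i; apply: (@norm_hausdorff K (E i)).
move=> M N Mx Ny.
have coord : continuous (fun x => (val (h x) : prod_algebra _) i).
  move=> z; apply: (@continuous_comp _ _ _ (fun z => val (h z))
      (fun t : prod_algebra _ => t i)); last exact: prod_coord_continuous.
  by apply: (@continuous_comp _ _ _ h val);
    [exact: ch | exact: subalgebra_val_continuous].
have [z [Mz Nz]] := xy _ _ (coord x M Mx) (coord y N Ny).
by exists ((val (h z) : prod_algebra _) i).
Qed.

(** * Factoring a homomorphism of limits through single coordinates *)

Definition factors_through (K : numFieldType) (d : Order.disp_t)
    (A : porderType d) (SX SY : projsys K A)
    (f : projlim SX -> projlim SY) (a b : A) : Prop :=
  exists2 g : SX b -> SY a, continuous g &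
    forall x, limproj a (f x) = g (limproj b x).

(** Embed [SY a] in a countable product of Banach algebras [E i]. Each
    coordinate [phi i] of [f] is bounded on a neighbourhood of 0 in the limit,
    hence on one pulled back from a single [SX (b i)]. Countably many indices
    [b i] have a common upper bound [s], so all [phi i] extend to [SX s], and the
    extensions together land in the closed copy of [SY a] because they do so on
    a dense set. *)
Lemma factors_through_exists (K : numFieldType) (d : Order.disp_t)
    (A : porderType d) (SX SY : projsys K A)
    (f : projlim SX -> projlim SY) (a : A) :
  projective_frechet SX ->
  frechet_algebra (SY a) -> continuous_hom f ->
  exists b, factors_through f a b.
Proof.
move=> [dA _ cA _ dX] [I [E [S [cS [h [[hl _ ch] [k [hK _ ck]]]]]]]] [fl _ cf].
have [ql _ cq] := limproj_hom SY a.
pose phi i (x : projlim SX) : E i :=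
  (val (h (limproj a (f x))) : prod_algebra _) i.
have phi_lin i : linear (phi i).
  by move=> c x y; rewrite /phi fl ql hl.
have phi_cont i : continuous (phi i).
  move=> x; apply: (@continuous_comp _ _ _ (fun x => val (h (limproj a (f x))))
    (fun t : prod_algebra _ => t i)); last exact: prod_coord_continuous.
  apply: (@continuous_comp _ _ _ (fun x => h (limproj a (f x))) val);
    last exact: subalgebra_val_continuous.
  apply: (@continuous_comp _ _ _ (fun x => limproj a (f x)) h); last exact: ch.
  by apply: (@continuous_comp _ _ _ f (@limproj _ _ _ SY a)); [exact: cf|exact: cq].
have bdd i : exists b, exists2 U : set (SX b), nbhs 0 U &
    forall x, U (limproj b x) -> `|phi i x| <= 1.
  have N0 : nbhs (0 : projlim SX) (phi i @^-1` ball (0 : E i) 1).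
    by apply: phi_cont; rewrite (linear_eq0 (phi_lin i)); exact: nbhsx_ballx.
  have [b [U [U0 UN]]] := projlim_nbhs a dA N0.
  exists b, U => // x /UN; rewrite /= -ball_normE /= sub0r normrN.
  exact: ltW.
have [b bP] := choice bdd.
have [s bs] := countable_family_bounded b a dA cA.
have ext i : exists g : SX s -> E i,
    continuous g /\ forall x, g (limproj s x) = phi i x.
  have [U U0 UP] := bP i; have [pl _ _] := limproj_hom SX s.
  apply: (@bounded_extension _ _ _ _ _ _
    (sys_map (bs i) @^-1` U) (dX s) pl (phi_lin i)).
    by have [_ _ cont] := sys_map_hom SX (bs i); apply: cont; rewrite sys_map0.
  by move=> x; rewrite /= limproj_sys_map; exact: UP.
pose g i := projT1 (cid (ext i)).
have gP i : continuous (g i) /\ forall x, g i (limproj s x) = phi i x.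
  exact: projT2 (cid (ext i)).
pose G v : prod_algebra (fun i => E i : topAlgebraType K) := fun i => g i v.
have cG : continuous G by apply: continuous_to_prod => i; exact: (gP i).1.
have GE x : G (limproj s x) = val (h (limproj a (f x))).
  by apply: functional_extensionality_dep => i; exact: (gP i).2.
have GS : forall v, subalg_set S (G v).
  apply: dense_range_closed cS (dX s) cG _ => x.
  by rewrite GE; apply/set_mem; exact: valP.
exists s; exists (fun v => k (subalg_elt (GS v))).
  move=> v; apply: (@continuous_comp _ _ _ (fun v => subalg_elt (GS v)) k);
    last exact: ck.
  by apply: continuous_to_sub; exact: cG.
move=> x; rewrite -[LHS]hK; congr k; apply: val_inj; exact/esym/GE.
Qed.

Lemma factors_through_le (K : numFieldType) (d : Order.disp_t)
    (A : porderType d) (SX SY : projsys K A)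
    (f : projlim SX -> projlim SY) (a b c : A) :
  factors_through f a b -> (b <= c)%O -> factors_through f a c.
Proof.
move=> [g cg gP] bc; exists (g \o sys_map bc) => [x|x].
  have [_ _ cont] := sys_map_hom SX bc.
  by apply: continuous_comp; [exact: cont | exact: cg].
by rewrite gP /= limproj_sys_map.
Qed.

(** The factorizations over the [u n] agree with the bonding maps on a dense
    set, hence everywhere; they form a map into the limit of the [SY (u n)],
    which is [SY s] by continuity of the system. *)
Lemma factors_through_sup (K : numFieldType) (d : Order.disp_t)
    (A : porderType d) (SX SY : projsys K A)
    (f : projlim SX -> projlim SY) (u : nat -> A) (s b : A) :
  projective_frechet SX -> projective_frechet SY ->
  {homo u : m n / (m <= n)%O} -> supremums (range u) s ->
  (forall n, factors_through f (u n) b) -> factors_through f s b.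
Proof.
move=> hX hY um us fac.
have ues n : (u n <= s)%O by apply: us.1; exists n.
have [_ [k [coneK _ ck]]] := pf_continuous hY um ues us.
pose g n := projT1 (cid2 (fac n)).
have cg n : continuous (g n) by rewrite /g; case: cid2.
have gP n x : limproj (u n) (f x) = g n (limproj b x) by rewrite /g; case: cid2.
have Gthread v : thread (S := reindex_sys SY um) (fun n => g n v).
  move=> m n mn.
  suff gC : (fun v => sys_map (um m n mn) (g n v)) =1 g m by exact: gC.
  apply: (dense_range_eq _ (pf_dense hX (a := b))) => [|||x].
  - exact: frechet_hausdorff (pf_frechet hY _).
  - have [_ _ cont] := sys_map_hom SY (um m n mn).
    by move=> w; apply: continuous_comp; [exact: cg | exact: cont].
  - exact: cg.
  - by rewrite -!gP; exact: limproj_sys_map.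
pose G v : projlim (reindex_sys SY um) :=
  @subalg_elt _ _ (thread_subalgebra (reindex_sys SY um)) _ (Gthread v).
have cG : continuous G.
  by apply: continuous_to_sub; apply: continuous_to_prod => n; exact: cg.
exists (k \o G) => [v|x].
  by apply: continuous_comp; [exact: cG | exact: ck].
rewrite -[LHS]coneK /=; congr k; apply: val_inj.
apply: functional_extensionality_dep => n.
by rewrite /= -gP; exact: limproj_sys_map.
Qed.

Lemma factors_through_hom (K : numFieldType) (d : Order.disp_t)
    (A : porderType d) (SX SY : projsys K A)
    (f : projlim SX -> projlim SY) (a b : A) (g : SX b -> SY a) :
  projective_frechet SX -> hausdorff_space (SY a) -> continuous_hom f ->
  continuous g -> (forall x, limproj a (f x) = g (limproj b x)) ->
  continuous_hom g.
Proof.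
move=> hX hY [fl fm cf] cg gP; have [ql qm cq] := limproj_hom SY a.
apply: (continuous_hom_dense hY (pf_dense hX (a := b)) (limproj_hom SX b) _ cg).
have -> : g \o @limproj _ _ _ SX b = @limproj _ _ _ SY a \o f.
  by apply/funext => x; rewrite /= gP.
split=> [c x y|x y|x]; rewrite /= ?fl ?ql ?fm ?qm//.
by apply: continuous_comp; [exact: cf | exact: cq].
Qed.

(** Compatibility of the factors with the bonding maps holds on the dense image
    of the limit, where both composites are given by [f]. *)
Lemma limit_of_diagonal_factors (K : numFieldType) (d : Order.disp_t)
    (A : porderType d) (SX SY : projsys K A)
    (f : projlim SX -> projlim SY) (B : set A) :
  projective_frechet SX -> projective_frechet SY -> continuous_hom f ->
  (forall b, B b -> factors_through f b b) ->
  exists fB : forall b : subindex B, subsystem SX B b -> subsystem SY B b,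
    sys_morphism fB /\ is_limit_of f fB.
Proof.
move=> hX hY hf fac.
have facB (b : subindex B) : factors_through f (val b) (val b).
  by apply: fac; apply/set_mem; exact: valP.
have fB_ex (b : subindex B) : exists g : SX (val b) -> SY (val b),
    continuous_hom g /\ forall x, limproj (val b) (f x) = g (limproj (val b) x).
  have [g cg gP] := facB b; exists g; split=> //.
  by apply: factors_through_hom cg gP => //; exact/frechet_hausdorff/pf_frechet.
pose fB b := projT1 (cid (fB_ex b)).
have fBhom b : continuous_hom (fB b) by rewrite /fB; case: cid => g [].
have fBP b x : limproj (val b) (f x) = fB b (limproj (val b) x).
  by rewrite /fB; case: cid => g [].
exists fB; split=> //; split=> [b|a b ab]; first exact: fBhom.
have [_ _ cfa] := fBhom a; have [_ _ cfb] := fBhom b.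
have [_ _ cX] := sys_map_hom (subsystem SX B) ab.
have [_ _ cY] := sys_map_hom (subsystem SY B) ab.
suff fC : (fun v => @sys_map _ _ _ (subsystem SY B) _ _ ab (fB b v)) =1
          (fun v => fB a (@sys_map _ _ _ (subsystem SX B) _ _ ab v)).
  exact: fC.
apply: (dense_range_eq _ (pf_dense hX (a := val b))) => [|||x].
- exact: frechet_hausdorff (pf_frechet hY _).
- by move=> v; apply: continuous_comp; [exact: cfb | exact: cY].
- by move=> v; apply: continuous_comp; [exact: cX | exact: cfa].
- rewrite -fBP [LHS]limproj_sys_map fBP; congr (fB a _).
  exact/esym/limproj_sys_map.
Qed.

Theorem theorem3p3 (R : realType) (d : Order.disp_t) (A : porderType d)
    (SX SY : projsys (complex R) A)
    (hX : projective_frechet SX) (hY : projective_frechet SY) :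
  (forall f : projlim SX -> projlim SY, continuous_hom f ->
    exists B : set A, cofinal B /\ omega_closed B /\
    exists fB : forall b : subindex B, subsystem SX B b -> subsystem SY B b,
      sys_morphism fB /\ is_limit_of f fB) /\
  (topologically_isomorphic (projlim SX) (projlim SY) ->
    exists B : set A, cofinal B /\ omega_closed B /\
      sys_isomorphic (subsystem SX B) (subsystem SY B)).
Proof.
have [dA cA] := (pf_directed hX, pf_complete hX).
split=> [f hf|[f [hf [g [fK gK cg]]]]].
  exists [set a | factors_through f a a].
  have [Bcof Bclosed] := diagonal_cofinal_omega_closed dA cA
    (fun a => factors_through_exists hX (pf_frechet hY a) hf)
    (@factors_through_le _ _ _ _ _ f)
    (fun u s b um us => factors_through_sup hX hY um us).
  by split=> //; split=> //; exact: limit_of_diagonal_factors.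
have hg : continuous_hom g.
  have [fl fm _] := hf; split=> // [c x y|x y]; apply: (can_inj fK).
    by rewrite fl !gK.
  by rewrite fm !gK.
(* One set of indices has to serve [f] and its inverse:
   the conjunction of the two factorization relations has the same closure
   properties as each of them. *)
pose L a b := factors_through f a b /\ factors_through g a b.
have [Bcof Bclosed] : cofinal [set a | L a a] /\ omega_closed [set a | L a a].
  apply: diagonal_cofinal_omega_closed => // [a|a b c [fab gab] bc|u s b um us Lub].
  - have [b fab] := factors_through_exists hX (pf_frechet hY a) hf.
    have [c gac] := factors_through_exists hY (pf_frechet hX a) hg.
    have [e [be ce]] := dA b c; exists e.
    by split; [exact: factors_through_le be | exact: factors_through_le ce].
  - by split; [exact: factors_through_le bc | exact: factors_through_le bc].
  - split; [apply: (factors_through_sup hX hY um us) => n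
           |apply: (factors_through_sup hY hX um us) => n].
    + by have [] := Lub n.
    + by have [] := Lub n.
exists [set a | L a a]; split=> //; split=> //.
have [fB [fBmor fBP]] :
    exists fB : forall b, subsystem SX _ b -> subsystem SY _ b,
      sys_morphism fB /\ is_limit_of (B := [set a | L a a]) f fB.
  by apply: limit_of_diagonal_factors => // b [].
have [gB [[gBhom _] gBP]] :
    exists gB : forall b, subsystem SY _ b -> subsystem SX _ b,
      sys_morphism gB /\ is_limit_of (B := [set a | L a a]) g gB.
  by apply: limit_of_diagonal_factors => // b [].
have [fBhom _] := fBmor.
(* [gB b] inverts [fB b] on the dense image of the limit, hence everywhere. *)
exists fB; split=> // b; split; first exact: fBhom.
have [_ _ cfb] := fBhom b; have [_ _ cgb] := gBhom b.
exists (gB b); split=> //.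
- apply: (dense_range_eq _ (pf_dense hX (a := val b))) => [|||x].
  + exact: frechet_hausdorff (pf_frechet hX _).
  + by move=> v; apply: continuous_comp; [exact: cfb | exact: cgb].
  + by move=> v; exact: cvg_id.
  + by rewrite -fBP -gBP fK.
- apply: (dense_range_eq _ (pf_dense hY (a := val b))) => [|||y].
  + exact: frechet_hausdorff (pf_frechet hY _).
  + by move=> v; apply: continuous_comp; [exact: cgb | exact: cfb].
  + by move=> v; exact: cvg_id.
  + by rewrite -gBP -fBP gK.
Qed.
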